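(* Let $(\Delta_K,\Delta_G,\Delta_H)$ be a Zappa–Szép Garside structure for the Zappa–Szép product $K=G\bowtie H$. Given the normal form $g_1h_1|\cdots|g_mh_m\in\overline{\mathcal L}_K$ (with $g_i\in G$, $h_i\in H$) of an element $k\in K$ with $GH$-decomposition $k=gh$, the following algorithm computes the normal forms $W_G\in\overline{\mathcal L}_G$ of $g$ and $W_H\in\overline{\mathcal L}_H$ of $h$. Initialise $W_H:=g_1h_1|g_2h_2|\cdots|g_mh_m$ and $W_G:=\varepsilon$ (the empty word). Repeat the following steps until $g'_1=\mathbf 1$: 1. Write each simple factor of $W_H$ as a $GH$-decomposition, $W_H=g'_1h'_1|g'_2h'_2|\cdots|g'_\ell h'_\ell$ with $g'_i\in G$, $h'_i\in H$ (if $W_H$ is the empty word, set $g'_1:=\mathbf 1$). 2. If $g'_1\neq\mathbf 1$: replace $W_G$ by $W_G.g'_1$; and replace $W_H$ by the word $h'_1g'_2\,|\,h'_2g'_3\,|\cdots|\,h'_{\ell-1}g'_\ell\,|\,h'_\ell$ if $h'_\ell\neq\mathbf 1$, and by the word $h'_1g'_2\,|\,h'_2g'_3\,|\cdots|\,h'_{\ell-1}g'_\ell$ if $h'_\ell=\mathbf 1$. Return $(W_G,W_H)$.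
   Context: Zappa–Szép product: for a monoid $K$ with submonoids $G,H$, write $K=G\bowtie H$ if for every $k\in K$ there exist unique $g_1,g_2\in G$ and $h_1,h_2\in H$ such that $g_1h_1=k=h_2g_2$; $k=g_1h_1$ is the $GH$-decomposition of $k$. Garside monoids: in a monoid $M$ with identity $\mathbf 1$, write $x\preccurlyeq y$ ($x$ is a prefix of $y$) if $y=xu$ for some $u\in M$, and $y\succcurlyeq x$ ($x$ is a suffix of $y$) if $y=ux$ for some $u\in M$. An atom is an element $a\neq\mathbf 1$ such that $a=uv$ implies $u=\mathbf 1$ or $v=\mathbf 1$. $M$ is atomic if it is generated by its atoms and for each $x\in M$ there is an upper bound on the lengths of decompositions of $x$ as a product of atoms. An element is balanced if its set of prefixes equals its set of suffixes; this common set is denoted $\mathrm{Div}(d)$. A Garside structure is a pair $(M,\Delta)$ where $M$ is a cancellative atomic monoid, the prefix and suffix relations are lattice orders, $\Delta\in M$ is balanced, $M$ is generated by $\mathrm{Div}(\Delta)$, and $\mathrm{Div}(\Delta)$ is finite. $M$ is a Garside monoid if such a $\Delta$ (a Garside element) exists. Zappa–Szép Garside structure: $(\Delta_K,\Delta_G,\Delta_H)$ is one for $K=G\bowtie H$ if $K$ is a Garside monoid (it then follows that $G$ and $H$ are Garside monoids), $\Delta_K,\Delta_G,\Delta_H$ are Garside elements of $K,G,H$ respectively, and $\Delta_K=\Delta_G\Delta_H$. Normal forms: for $M\in\{K,G,H\}$ let $\mathcal D_M=\mathrm{Div}(\Delta_M)$ (the simple elements) and, for $x\in\mathcal D_M$,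 let $\partial_Mx\in\mathcal D_M$ be the unique element with $x\,\partial_Mx=\Delta_M$. Let $\wedge$ denote the meet for the prefix order. $\overline{\mathcal L}_M$ is the set of all words $x_1.x_2.\cdots.x_n$ ($n\ge 0$, including the empty word) over the alphabet $\mathcal D_M\setminus\{\mathbf 1\}$ such that $\partial_Mx_i\wedge x_{i+1}=\mathbf 1$ for $1\le i<n$; $x_1|\cdots|x_n$ denotes such a word. The normal form of $x\in M$ is the unique word $x_1|\cdots|x_n\in\overline{\mathcal L}_M$ with $x=x_1\cdots x_n$. *)

(* Defs.v *)
From HB Require Import structures.
From mathcomp Require Import all_boot.
From mathcomp Require Import boolp classical_sets cardinality.

Set Implicit Arguments.
Unset Strict Implicit.
Unset Printing Implicit Defensive.

Local Open Scope classical_set_scope.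
Local Open Scope group_scope.

(* Submonoids are subsets of an ambient monoid K. All notions attached to a
   monoid M are stated for a submonoid M of K and are internal to it: the
   quotients, decompositions and bounds range over M only. The monoid K itself
   is the case M := setT. *)
Section Garside.
Variable K : monoidType.
Implicit Types (M A : set K) (x y d m : K) (w : seq K).

Definition submonoid M := M 1 /\ forall x y, M x -> M y -> M (x * y).

Definition prefix_in M x y := exists2 u, M u & y = x * u.
Definition suffix_in M x y := exists2 u, M u & y = u * x.

Definition cancellative M := forall x y z, M x -> M y -> M z ->
  (x * y = x * z -> y = z) /\ (y * x = z * x -> y = z).

Definition atom M x :=
  [/\ M x, x <> 1 & forall u v, M u -> M v -> x = u * v -> u = 1 \/ v = 1].

Definition word_over A w := forall x, x \in w -> A x.

Definition generated_by M A :=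
  forall x, M x -> exists2 w, word_over A w & \prod_(y <- w) y = x.

Definition atomic M :=
  generated_by M (atom M) /\
  forall x, M x -> exists N, forall w,
    word_over (atom M) w -> \prod_(y <- w) y = x -> size w <= N.

Definition is_meet M (le : K -> K -> Prop) x y m :=
  [/\ M m, le m x, le m y &
      forall z, M z -> le z x -> le z y -> le z m].

Definition is_join M (le : K -> K -> Prop) x y m :=
  [/\ M m, le x m, le y m &
      forall z, M z -> le x z -> le y z -> le m z].

Definition lattice_order M (le : K -> K -> Prop) :=
  [/\ forall x, M x -> le x x,
      forall x y, M x -> M y -> le x y -> le y x -> x = y,
      forall x y z, M x -> M y -> M z -> le x y -> le y z -> le x z,
      forall x y, M x -> M y -> exists m, is_meet M le x y m &
      forall x y, M x -> M y -> exists m, is_join M le x y m].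

Definition Div M d := [set x | M x /\ prefix_in M x d].

Definition balanced M d := Div M d = [set x | M x /\ suffix_in M x d].

Definition garside_structure M d :=
  [/\ cancellative M, atomic M,
      lattice_order M (prefix_in M) /\ lattice_order M (suffix_in M),
      M d /\ balanced M d &
      generated_by M (Div M d) /\ finite_set (Div M d)].

Definition garside_monoid M := exists d, garside_structure M d.

Definition is_complement M d x y := Div M d y /\ x * y = d.

Definition normal_pair M d x y :=
  exists2 c, is_complement M d x c & is_meet M (prefix_in M) c y 1.

Definition normal_word M d w :=
  word_over (Div M d `\ 1) w /\
  forall i, i.+1 < size w -> normal_pair M d (nth 1 w i) (nth 1 w i.+1).

Definition normal_form M d x w :=
  normal_word M d w /\ \prod_(y <- w) y = x.

End Garside.

Section ZappaSzep.
Variable K : monoidType.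
Implicit Types (A B G H : set K) (k : K) (w : seq K) (s : seq K * seq K).

Definition decomposition A B k (p : K * K) :=
  [/\ A p.1, B p.2 & k = p.1 * p.2].

Definition zappa_szep G H := forall k,
  (exists! p, decomposition G H k p) /\ (exists! p, decomposition H G k p).

Definition zs_garside_structure G H (dK dG dH : K) :=
  garside_monoid [set: K] /\
  [/\ garside_structure [set: K] dK, garside_structure G dG,
      garside_structure H dH & dK = dG * dH].

(* The default value (1, 1) is never used when K is the Zappa-Szep product of
   G and H. *)
Definition GHdec G H k : K * K := xget (1, 1) (decomposition G H k).
Definition Gpart G H k := (GHdec G H k).1.
Definition Hpart G H k := (GHdec G H k).2.

Definition first_Gpart G H w := head 1 (map (Gpart G H) w).

(* From g_1 h_1 . ... . g_l h_l with l >= 1 to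
   h_1 g_2 . h_2 g_3 . ... . h_(l-1) g_l . h_l, without h_l if it is 1. *)
Definition shift_word G H w :=
  let gs := map (Gpart G H) w in
  let hs := map (Hpart G H) w in
  [seq p.1 * p.2 | p <- zip hs (behead gs)] ++
  (if last 1 hs == 1 then [::] else [:: last 1 hs]).

Definition halted G H s := first_Gpart G H s.2 == 1.

(* A state is a pair (W_G, W_H); halted states are left unchanged. *)
Definition step G H s :=
  if halted G H s then s
  else (rcons s.1 (first_Gpart G H s.2), shift_word G H s.2).

Definition run G H w n := iter n (step G H) ([::], w).

End ZappaSzep.

(* Main.v *)
(* G and H are closed under factors, the G-part of k is its greatest prefix in
   G, Delta_K = Delta_H Delta_G, and Div(Delta_G), Div(Delta_H) are the simple
   elements of K lying in G, H; hence gh and hg are simple for all simple g in G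
   and h in H.  A word is normal iff, for consecutive letters x, y, no nontrivial
   prefix z of y makes xz simple.  If a simple ga with a in G and a dividing h y
   existed, the join of ga and gh would be gh z with z a prefix of y, so
   normality of gh|y forces z = 1 and a = 1; this yields normality both of the
   shifted word and of W_G.  The product W_G W_H is invariant, and W_G cannot
   grow indefinitely because K is atomic. *)
Require Import Defs.
From mathcomp Require Import all_boot.
From mathcomp Require Import boolp classical_sets.

Set Implicit Arguments.
Unset Strict Implicit.
Unset Printing Implicit Defensive.

Local Open Scope classical_set_scope.
Local Open Scope group_scope.

(** * Garside monoids and normal pairs *)

Lemma garside_conical (K : monoidType) (d : K) :
  garside_structure [set: K] d ->
  forall x y : K, x * y = 1 -> x = 1 /\ y = 1.
Proof.
case=> _ _ [[_ anti _ _ _] _] _ _ x y xy.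
have x1 : x = 1.
  by apply: anti => //; [exists y | exists x => //; rewrite mul1g].
by split=> //; rewrite x1 mul1g in xy.
Qed.

Lemma garside_lcancel (K : monoidType) (d : K) :
  garside_structure [set: K] d -> forall x y z : K, x * y = x * z -> y = z.
Proof. by case=> cK _ _ _ _ x y z; apply: (proj1 (cK x y z I I I)). Qed.

Lemma garside_rcancel (K : monoidType) (d : K) :
  garside_structure [set: K] d -> forall x y z : K, y * x = z * x -> y = z.
Proof. by case=> cK _ _ _ _ x y z; apply: (proj2 (cK x y z I I I)). Qed.

Lemma Div_suffixP (K : monoidType) (M : set K) (d x : K) :
  balanced M d -> Div M d x <-> M x /\ suffix_in M x d.
Proof. by rewrite /balanced => ->. Qed.

Lemma Div_factor (K : monoidType) (d x y z : K) :
  balanced [set: K] d -> x * y * z = d -> Div [set: K] d y.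
Proof.
move=> bal e.
have [|_ [u _ du]] := proj2 (Div_suffixP (y * z) bal).
  by split=> //; exists x; rewrite // mulgA.
by split=> //; exists (z * u); rewrite // mulgA.
Qed.

(** Cancelling [x] identifies the prefixes of its complement with the [z] for which [x * z] divides
    [d], so the meet condition becomes a condition on such [z]. *)
Lemma normal_pairP (K : monoidType) (M : set K) (d x y : K) :
  (forall u v : K, u * v = 1 -> u = 1 /\ v = 1) ->
  submonoid M -> cancellative M -> M d -> balanced M d ->
  Div M d x -> M y ->
  normal_pair M d x y <->
  (forall z, M z -> prefix_in M z y -> Div M d (x * z) -> z = 1).
Proof.
move=> con [M1 MM] cM Md bal [Mx [c Mc dE]] My; split.
  move=> [c' [[Mc' _] dE'] [_ _ _ meet]] z Mz zy [_ [u Mu du]].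
  have [|v _ /esym/con[]//] := meet z Mz _ zy.
  exists u => //; apply: (proj1 (cM x c' (z * u) Mx Mc' (MM _ _ Mz Mu))).
  by rewrite mulgA -du.
move=> triv; exists c.
  split=> //; apply/(Div_suffixP _ bal); split=> //; by exists x.
split=> //; first by exists c; rewrite ?mul1g.
  by exists y; rewrite ?mul1g.
move=> z Mz [u Mu cE] zy; exists 1 => //.
rewrite (triv z Mz zy) ?mulg1 //.
by split; [apply: MM | exists u; rewrite // -mulgA -cE].
Qed.

(** * Factors and divisibility in Zappa-Szép products *)

Lemma zappa_szepC (K : monoidType) (G H : set K) :
  zappa_szep G H -> zappa_szep H G.
Proof. by move=> zs k; have [] := zs k. Qed.

Lemma zappa_szep_dec (K : monoidType) (G H : set K) (k : K) :
  zappa_szep G H -> exists a b, [/\ G a, H b & k = a * b].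
Proof.
by move=> zs; have [[[a b] [[Ga Hb kE] _]] _] := zs k; exists a, b.
Qed.

Lemma zappa_szep_inj (K : monoidType) (G H : set K) (a b a' b' : K) :
  zappa_szep G H -> G a -> H b -> G a' -> H b' -> a * b = a' * b' ->
  a = a' /\ b = b'.
Proof.
move=> zs Ga Hb Ga' Hb' e; have [[p [_ uni]] _] := zs (a * b).
have p1 : p = (a, b) by apply: uni.
have p2 : p = (a', b') by apply: uni.
by move: p2; rewrite p1 => -[-> ->].
Qed.

(** Write [x = g1 * h1], [y = h2 * g2] and [h1 * h2 * g2 = g3 * h3]. Uniqueness of the
    GH-decomposition of [x * y] forces [h3 = 1]; uniqueness of the HG-decomposition of [g3] then
    gives [h1 * h2 = 1], hence [h1 = h2 = 1]. *)
Lemma zappa_szep_factor (K : monoidType) (G H : set K) (x y : K) :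
  (forall u v : K, u * v = 1 -> u = 1 /\ v = 1) ->
  submonoid G -> submonoid H -> zappa_szep G H ->
  G (x * y) -> G x /\ G y.
Proof.
move=> con [G1 GM] [H1 HM] zs Gxy.
have zs' := zappa_szepC zs.
have [g1 [h1 [Gg1 Hh1 xE]]] := zappa_szep_dec x zs.
have [h2 [g2 [Hh2 Gg2 yE]]] := zappa_szep_dec y zs'.
have [g3 [h3 [Gg3 Hh3 zE]]] := zappa_szep_dec (h1 * h2 * g2) zs.
have xyE : x * y = g1 * g3 * h3.
  by rewrite xE yE -!mulgA -zE !mulgA.
have [_ h31] : g1 * g3 = x * y /\ h3 = 1.
  by apply: (zappa_szep_inj zs) => //; [apply: GM | rewrite mulg1].
have [/con[h11 h21] _] : h1 * h2 = 1 /\ g2 = g3.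
  apply: (zappa_szep_inj zs') => //; first exact: HM.
  by rewrite mul1g zE h31 mulg1.
by rewrite xE yE h11 h21 mulg1 mul1g.
Qed.

Lemma zappa_szep_prefix (K : monoidType) (G H : set K) (x a b : K) :
  submonoid G -> zappa_szep G H -> G x -> G a -> H b ->
  prefix_in [set: K] x (a * b) -> prefix_in G x a.
Proof.
move=> [_ GM] zs Gx Ga Hb [u _ e].
have [c [b' [Gc Hb' uE]]] := zappa_szep_dec u zs.
have [aE _] : a = x * c /\ b = b'.
  by apply: (zappa_szep_inj zs) => //; [apply: GM | rewrite e uE mulgA].
by exists c.
Qed.

Lemma zappa_szep_suffix (K : monoidType) (G H : set K) (x a b : K) :
  submonoid H -> zappa_szep G H -> H x -> G a -> H b ->
  suffix_in [set: K] x (a * b) -> suffix_in H x b.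
Proof.
move=> [_ HM] zs Hx Ga Hb [u _ e].
have [a' [c [Ga' Hc uE]]] := zappa_szep_dec u zs.
have [_ bE] : a = a' /\ b = c * x.
  by apply: (zappa_szep_inj zs) => //; [apply: HM | rewrite e uE mulgA].
by exists c.
Qed.

(** * Lengths and extensions of words *)

(** A nontrivial letter expands into at least one atom, so refining [w] into atoms does not shorten
    it. The factor [y] allows [w] to spell only a prefix of [k], as [W_G] does during a run. *)
Lemma atomic_size_bounded (K : monoidType) (k : K) :
  atomic [set: K] ->
  exists N, forall (w : seq K) (y : K), word_over (~` [set 1]) w ->
    \prod_(x <- w) x * y = k -> size w <= N.
Proof.
move=> [gen bnd]; have [N HN] := bnd k I; exists N => w y nw wy.
have [wy' Awy' wyE] := gen y I.
suff [w' [Aw' w'E lew]] : exists w' : seq K,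
    [/\ word_over (atom [set: K]) w', \prod_(x <- w') x = \prod_(x <- w) x
      & size w <= size w'].
  apply: leq_trans lew _.
  have := HN (w' ++ wy'); rewrite size_cat => HN'.
  apply: leq_trans (leq_addr _ _) (HN' _ _).
    by move=> x; rewrite mem_cat => /orP[/Aw'|/Awy'].
  by rewrite big_cat /= w'E wyE.
elim: w {wy} nw => [|x w IH] nw; first by exists [::]; split=> // x.
have [|w' [Aw' w'E lew]] := IH.
  by move=> z zw; apply: nw; rewrite inE zw orbT.
have [wx Awx wxE] := gen x I.
exists (wx ++ w'); split.
- by move=> z; rewrite mem_cat => /orP[/Awx|/Aw'].
- by rewrite big_cat /= wxE w'E big_cons.
rewrite size_cat /= -add1n leq_add //.
case: wx {Awx} wxE => // xE; case: (nw x); first exact: mem_head.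
by rewrite -xE big_nil.
Qed.

Lemma normal_word_rcons (K : monoidType) (M : set K) d w x :
  normal_word M d w -> (Div M d `\ 1) x ->
  (w <> [::] -> normal_pair M d (last 1 w) x) -> normal_word M d (rcons w x).
Proof.
move=> [ow nw] Dx nx; split=> [y|i].
  by rewrite mem_rcons inE => /orP[/eqP->|/ow].
rewrite size_rcons ltnS => iw; rewrite !nth_rcons iw.
case: ltnP => iw'; first exact: nw.
have sE : size w = i.+1 by apply/eqP; rewrite eqn_leq iw iw'.
rewrite sE eqxx -[i]/(i.+1.-1) -sE nth_last; apply: nx.
by case: w sE {ow nw iw iw'}.
Qed.

Lemma prod_closed (K : monoidType) (M : set K) w :
  submonoid M -> word_over M w -> M (\prod_(x <- w) x).
Proof.
by move=> [M1 MM] ow; rewrite big_seq; apply: big_ind.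
Qed.

(** * Simple elements of the product and of its factors *)

Section ZappaSzepGarside.
Variables (K : monoidType) (G H : set K) (dK dG dH : K).
Hypotheses (hG : submonoid G) (hH : submonoid H) (zs : zappa_szep G H).
Hypotheses (gK : garside_structure [set: K] dK).
Hypotheses (gG : garside_structure G dG) (gH : garside_structure H dH).
Hypothesis dKE : dK = dG * dH.

Let con := garside_conical gK.
Let zs' := zappa_szepC zs.
Let balK : balanced [set: K] dK. Proof. by case: gK => _ _ _ []. Qed.
Let simple := Div [set: K] dK.
Let gp := Gpart G H.
Let hp := Hpart G H.

Lemma Div_G x : Div G dG x <-> G x /\ simple x.
Proof.
have [_ _ _ [GdG _] _] := gG; have [_ _ _ [HdH _] _] := gH.
split=> [[Gx [u Gu dE]]|[Gx [_ px]]].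
  by split=> //; split=> //; exists (u * dH); rewrite // mulgA -dE.
by split=> //; apply: (zappa_szep_prefix (b := dH) hG zs); rewrite -?dKE.
Qed.

(** Since [dH] is the right factor of [dK], the argument for [G] is mirrored with suffixes, and
    balancedness translates back to prefixes. *)
Lemma Div_H x : Div H dH x <-> H x /\ simple x.
Proof.
have [_ _ _ [GdG _] _] := gG; have [_ _ _ [HdH balH] _] := gH.
split=> [/(Div_suffixP _ balH)[Hx [u Hu dE]]|].
  split=> //; apply/(Div_suffixP _ balK); split=> //.
  by exists (dG * u); rewrite // -mulgA -dE.
move=> [Hx /(Div_suffixP _ balK)[_ sx]]; apply/(Div_suffixP _ balH); split=> //.
by apply: (zappa_szep_suffix (a := dG) hH zs); rewrite -?dKE.
Qed.

(** Write [dK = b * a] with [b] in [H] and [a] in [G]. Being simple, [b] is a prefix of [dH]; being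
    simple, [dH] is a prefix of [b]; so [b = dH]. Suffixes give [a = dG] in the same way. *)
Lemma delta_HG : dK = dH * dG.
Proof.
have [_ _ _ [GdG balG] _] := gG; have [_ _ _ [HdH balH] _] := gH.
have lc := garside_lcancel gK; have rc := garside_rcancel gK.
have [b [a [Hb Ga dE]]] := zappa_szep_dec dK zs'.
have [_ [u Hu bE]] : Div H dH b.
  by apply/Div_H; split=> //; split=> //; exists a.
have [v Hv bE'] : prefix_in H dH b.
  apply: (zappa_szep_prefix (b := a) hH zs') => //; rewrite -dE.
  apply: (proj2 (proj2 (proj1 (Div_H dH) _))); split=> //.
  by exists 1; rewrite ?mulg1 //; case: hH.
have [v1 _] : v = 1 /\ u = 1.
  by apply: con; apply: (lc dH); rewrite mulgA -bE' -bE mulg1.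
have {}bE : b = dH by rewrite bE' v1 mulg1.
have /(Div_suffixP _ balG)[_ [s Gs aE]] : Div G dG a.
  apply/Div_G; split=> //; apply/(Div_suffixP _ balK); split=> //; by exists b.
have [t Gt aE'] : suffix_in G dG a.
  apply: (zappa_szep_suffix (a := b) hG zs') => //; rewrite -dE.
  have /(Div_suffixP _ balK)[] // : simple dG.
  by split=> //; exists dH.
have [_ t1] : s = 1 /\ t = 1.
  by apply: con; apply: (rc dG); rewrite -mulgA -aE' -aE mul1g.
by rewrite dE bE aE' t1 mul1g.
Qed.

(** As [a] is a suffix of [dG] and [b] a prefix of [dH], their product is a middle factor of
    [dG * dH]. *)
Lemma simpleGH a b : Div G dG a -> Div H dH b -> simple (a * b).
Proof.
have [_ _ _ [GdG balG] _] := gG; have [_ _ _ [HdH balH] _] := gH.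
move=> /(Div_suffixP _ balG)[_ [u _ aE]] [_ [v _ bE]].
by apply: (Div_factor (x := u) (z := v) balK); rewrite dKE aE bE !mulgA.
Qed.

Lemma simpleHG a b : Div G dG a -> Div H dH b -> simple (b * a).
Proof.
have [_ _ _ [GdG balG] _] := gG; have [_ _ _ [HdH balH] _] := gH.
move=> [_ [v _ aE]] /(Div_suffixP _ balH)[_ [u _ bE]].
by apply: (Div_factor (x := u) (z := v) balK); rewrite delta_HG aE bE !mulgA.
Qed.

Lemma simple_prefix x y : simple (x * y) -> simple x.
Proof. by move=> [_ [u _ e]]; split=> //; exists (y * u); rewrite // mulgA. Qed.

Lemma simple_suffix x y : simple (x * y) -> simple y.
Proof. by move=> [_ [u _ e]]; apply: Div_factor balK (esym e). Qed.

Lemma simple1 : simple 1.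
Proof. by split=> //; exists dK; rewrite // mul1g. Qed.

(** * Normal pairs and GH-parts of their letters *)

Lemma normal_pairK x y : simple x -> normal_pair [set: K] dK x y <->
  (forall z u, y = z * u -> simple (x * z) -> z = 1).
Proof.
move=> sx; have [cK _ _ _ _] := gK.
apply: (iff_trans (normal_pairP (M := setT) con _ cK _ balK sx I)) => //.
split=> [nf z u yE|nf z _ [u _ yE]]; last exact: nf yE.
by apply: nf => //; exists u.
Qed.

Lemma GHpartP x : [/\ G (gp x), H (hp x) & x = gp x * hp x].
Proof.
have [a [b [Ga Hb xE]]] := zappa_szep_dec x zs.
by apply: (@xgetPex _ _ (decomposition G H x)); exists (a, b).
Qed.

Lemma GHpart_mul a b : G a -> H b -> gp (a * b) = a /\ hp (a * b) = b.
Proof.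
move=> Ga Hb; have [Gg Hh e] := GHpartP (a * b).
by apply: (zappa_szep_inj zs).
Qed.

Lemma GHpart1 : gp 1 = 1 /\ hp 1 = 1.
Proof.
by have := @GHpart_mul 1 1; rewrite mulg1; apply; [case: hG | case: hH].
Qed.

Lemma Div_GHpart x : simple x -> Div G dG (gp x) /\ Div H dH (hp x).
Proof.
have [Gg Hh e] := GHpartP x; rewrite [in simple _]e => sx.
split; first by apply/Div_G; split=> //; apply: simple_prefix sx.
by apply/Div_H; split=> //; apply: simple_suffix sx.
Qed.

(* If [g * a] is simple, then so is the join [g * (a \/ h)] of [g * a] and
   [g * h]; it has the form [g * h * z] with [z] a prefix of [y]. *)
Lemma normal_pair_G g h y a u v :
  G g -> H h -> normal_pair [set: K] dK (g * h) y -> simple (g * h) ->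
  G a -> simple (g * a) -> y = u * v -> prefix_in [set: K] a (h * u) ->
  a = 1.
Proof.
move=> Gg Hh np sgh Ga [_ [s _ sE]] yE [r _ rE].
have [_ _ [[_ _ _ _ joins] _] _ _] := gK.
have lc := garside_lcancel gK.
have [m [_ [p _ pE] [q _ qE] lub]] := joins (g * a) (g * h) I I.
have sm : simple m.
  split=> //; apply: lub => //; first by exists s.
  by case: sgh.
have [t _ tE] : prefix_in [set: K] m (g * h * u).
  apply: lub => //; last by exists u.
  by exists r; rewrite // -!mulgA rE.
have uE : u = q * t by apply: (lc (g * h)); rewrite tE qE mulgA.
have q1 : q = 1.
  by apply: (proj1 (normal_pairK y sgh) np q (t * v));
    rewrite -?qE // yE uE mulgA.
have hE : h = a * p.
  by apply: (lc g); rewrite mulgA -pE qE q1 mulg1.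
(* As a factor of [h], [a] lies in [H] as well as in [G], so [a * 1] and [1 * a] are both
   GH-decompositions of it. *)
have [Ha _] : H a /\ H p.
  by apply: (zappa_szep_factor con hH hG zs'); rewrite -hE.
have [//] : a = 1 /\ 1 = a.
apply: (zappa_szep_inj zs) => //; rewrite ?mulg1 ?mul1g //.
  by case: hH.
by case: hG.
Qed.

(** An offending prefix [t] is eliminated in two stages: normality of [y|z] kills its G-part,
    normality of [x|y] the remaining H-part. *)
Lemma normal_pair_shift x y z :
  simple x -> simple y -> simple z ->
  normal_pair [set: K] dK x y -> normal_pair [set: K] dK y z ->
  normal_pair [set: K] dK (hp x * gp y) (hp y * gp z).
Proof.
move=> sx sy sz nxy nyz.
have [Ggx Hhx xE] := GHpartP x; have [Ggy Hhy yE] := GHpartP y.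
have [Ggz Hhz zE] := GHpartP z.
have [Dgx Dhx] := Div_GHpart sx; have [Dgy Dhy] := Div_GHpart sy.
apply/normal_pairK; first exact: simpleHG.
move=> t u tE st.
have [Ggt Hht tdec] := GHpartP t.
have gt1 : gp t = 1.
  apply: (@normal_pair_G (gp y) (hp y) z (gp t) (gp z) (hp z)); rewrite -?yE //.
    apply: (@simple_suffix (hp x)); apply: (@simple_prefix _ (hp t)).
    by rewrite -!mulgA -tdec mulgA.
  by exists (hp t * u); rewrite // mulgA -tdec.
rewrite gt1 mul1g in tdec.
have Ht : H t by rewrite tdec.
have [v Hv hyE] : prefix_in H t (hp y).
  by apply: (zappa_szep_prefix (b := gp z) hH zs') => //; exists u.
(* Now [b] is a prefix of [y], and [x * b = gp x * (hp x * b)] is simple, so [b = 1]; then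
   [gp y * t] lies in [G], which forces [t = 1]. *)
have [b [a [Hb Ga baE]]] := zappa_szep_dec (gp y * t) zs'.
have b1 : b = 1.
  apply: (proj1 (normal_pairK y sx) nxy b (a * v)).
    by rewrite mulgA -baE -mulgA -hyE.
  rewrite xE -mulgA; apply: simpleGH => //; apply/Div_H; split.
    by case: hH => _; apply.
  by apply: (@simple_prefix _ a); rewrite -mulgA -baE mulgA.
have [_ //] : gp y = a /\ t = 1.
apply: (zappa_szep_inj zs) => //; first by case: hH.
by rewrite baE b1 mul1g mulg1.
Qed.

(** Otherwise [x] lies in [G] and [y] in [H], so [x * y] is simple and normality forces [y = 1]. *)
Lemma hp_mul_gp_neq1 x y : simple x -> simple y ->
  normal_pair [set: K] dK x y -> y <> 1 -> hp x * gp y <> 1.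
Proof.
move=> sx sy nxy y1 /con[h1 g1].
have [_ _ xE] := GHpartP x; have [_ _ yE] := GHpartP y.
have [Dgx _] := Div_GHpart sx; have [_ Dhy] := Div_GHpart sy.
rewrite h1 mulg1 in xE; rewrite g1 mul1g in yE.
apply: y1; apply: (proj1 (normal_pairK y sx) nxy y 1); first by rewrite mulg1.
by rewrite xE yE; apply: simpleGH.
Qed.

Lemma normal_pair_G_shift x y : simple x -> simple y ->
  normal_pair [set: K] dK x y ->
  normal_pair G dG (gp x) (gp (hp x * gp y)).
Proof.
move=> sx sy nxy; have [cG _ _ [GdG balG] _] := gG.
have [Ggx Hhx xE] := GHpartP x; have [Ggy Hhy yE] := GHpartP y.
have [Dgx _] := Div_GHpart sx.
have [Gn _ nE] := GHpartP (hp x * gp y).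
apply/(normal_pairP con hG cG GdG balG Dgx Gn) => a Ga [u _ pE] /Div_G[_ sa].
apply: (@normal_pair_G (gp x) (hp x) y a (gp y) (hp y)); rewrite -?xE //.
by exists (u * hp (hp x * gp y)); rewrite // mulgA -pE -nE.
Qed.

(** * Letters, product and normality of the shifted word *)

Lemma normal_pair1 x : simple x -> normal_pair [set: K] dK x 1.
Proof. by move=> sx; apply/normal_pairK => // z u /esym/con[]. Qed.

(** The default letter [1] makes one formula cover all positions: the last letter is its H-part
    times [gp 1 = 1], and dropping it when trivial is invisible to [nth]. *)
Lemma nth_shift_word w i :
  nth 1 (shift_word G H w) i = hp (nth 1 w i) * gp (nth 1 w i.+1).
Proof.
have [g1 h1] := GHpart1.
elim: w i => [|x [|y w] IH] i.
- by rewrite /shift_word /= eqxx !nth_nil h1 g1 mulg1.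
- rewrite /shift_word /= -/(hp x); case: eqP => [e|_]; case: i => [|i] /=;
  by rewrite ?nth_nil ?e ?g1 ?h1 ?mulg1.
by case: i => [//|i]; rewrite -[RHS]IH.
Qed.

Lemma size_shift_word w : (size (shift_word G H w) <= size w) /\
  (size (shift_word G H w) = size w -> w <> [::] -> hp (last 1 w) <> 1).
Proof.
elim: w => [|x [|y w] [IH1 IH2]]; first by rewrite /shift_word /= eqxx.
  by rewrite /shift_word /= -/(hp x); case: eqP.
by split=> [|[e] _]; [apply: IH1 | apply: IH2].
Qed.

Lemma first_Gpart_nth w : first_Gpart G H w = gp (nth 1 w 0).
Proof. by case: w => //=; have [] := GHpart1. Qed.

Lemma prod_shift_word w :
  first_Gpart G H w * \prod_(x <- shift_word G H w) x = \prod_(x <- w) x.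
Proof.
elim: w => [|x [|y w] IH].
- by rewrite /shift_word /= eqxx big_nil mulg1.
- have [_ _ xE] := GHpartP x.
  rewrite /shift_word /= -/(hp x) -/(gp x) big_seq1 [RHS]xE.
  by case: eqP => [->|_]; rewrite ?big_nil ?big_seq1.
have [_ _ xE] := GHpartP x.
have -> : shift_word G H [:: x, y & w] = hp x * gp y :: shift_word G H (y :: w).
  by [].
by rewrite [RHS]big_cons -IH [in LHS]big_cons /= [x in RHS]xE !mulgA.
Qed.

Lemma normal_word_simple w i :
  normal_word [set: K] dK w -> simple (nth 1 w i).
Proof.
move=> [ow _]; case: (ltnP i (size w)) => iw; last first.
  by rewrite nth_default //; apply: simple1.
by have [] := ow _ (mem_nth 1 iw).
Qed.

Lemma normal_word_pair w i : normal_word [set: K] dK w ->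
  normal_pair [set: K] dK (nth 1 w i) (nth 1 w i.+1).
Proof.
move=> nw; case: (ltnP i.+1 (size w)) => iw; first exact: (proj2 nw).
by rewrite [nth 1 w i.+1]nth_default //; apply/normal_pair1/normal_word_simple.
Qed.

Lemma normal_word_shift w :
  normal_word [set: K] dK w -> normal_word [set: K] dK (shift_word G H w).
Proof.
move=> nw; have [les eqs] := size_shift_word w; split; last first.
  move=> i _; rewrite !nth_shift_word.
  by apply: normal_pair_shift; try exact: normal_word_simple;
    apply: normal_word_pair.
move=> x /(nthP 1)[i lti <-]; rewrite nth_shift_word.
have [_ Dh] := Div_GHpart (normal_word_simple i nw).
have [Dg _] := Div_GHpart (normal_word_simple i.+1 nw).
split; first exact: simpleHG.
case: (ltnP i.+1 (size w)) => iw.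
  apply: hp_mul_gp_neq1; try exact: normal_word_simple.
    exact: normal_word_pair.
  by have [] := proj1 nw _ (mem_nth 1 iw).
(* Here [i] is the last position of [w]; since the shifted word still has a letter there, the final
   H-part was not dropped. *)
have sE : size w = i.+1 by apply/eqP; rewrite eqn_leq iw (leq_trans lti).
rewrite [nth 1 w i.+1]nth_default // (proj1 GHpart1) mulg1.
rewrite -[i]/(i.+1.-1) -sE nth_last; apply: eqs.
  by apply/eqP; rewrite eqn_leq les sE.
by case: w sE {nw les lti iw Dh Dg}.
Qed.

(** * Correctness and termination of the run *)

(** Trivial G-parts propagate to the right: if a letter lies in [H], its product with the G-part of
    the next letter is simple, so normality makes that G-part trivial. *)
Lemma halted_normal_word w : normal_word [set: K] dK w ->
  first_Gpart G H w = 1 -> normal_word H dH w.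
Proof.
rewrite first_Gpart_nth => nw g1; have [cH _ _ [HdH balH] _] := gH.
have Hw i : H (nth 1 w i).
  have [_ Hh wE] := GHpartP (nth 1 w i).
  suff gi : gp (nth 1 w i) = 1 by rewrite wE gi mul1g.
  elim: i {Hh wE} => // i IH.
  have [_ _ wE] := GHpartP (nth 1 w i.+1).
  have sx := normal_word_simple i nw; have sy := normal_word_simple i.+1 nw.
  apply: (proj1 (normal_pairK _ sx) (normal_word_pair i nw) _ _ wE).
  have [_ _ ->] := GHpartP (nth 1 w i); rewrite IH mul1g.
  by apply: simpleHG; [have [] := Div_GHpart sy | have [] := Div_GHpart sx].
have Dw i : Div H dH (nth 1 w i).
  by apply/Div_H; split=> //; apply: normal_word_simple.
split=> [x xw|i iw].
  split; first by have [i _ <-] := nthP 1 xw.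
  by have [] := proj1 nw x xw.
apply/(normal_pairP con hH cH HdH balH (Dw i) (Hw i.+1)).
move=> z _ [u _ e] /Div_H[_ sz].
exact: (proj1 (normal_pairK _ (normal_word_simple i nw))
              (normal_word_pair i nw) z u).
Qed.

(** The third clause anticipates the next letter of [W_G], so that appending it preserves normality;
    the last one records that each non-halted step appends exactly one letter. *)
Lemma run_invariant k w n : normal_form [set: K] dK k w ->
  let s := run G H w n in
  [/\ normal_word [set: K] dK s.2, normal_word G dG s.1,
      s.1 <> [::] -> normal_pair G dG (last 1 s.1) (first_Gpart G H s.2),
      \prod_(x <- s.1) x * \prod_(x <- s.2) x = k
    & halted G H s \/ size s.1 = n].
Proof.
move=> [nw wE]; elim: n => [|n].
  by split=> //=; [rewrite big_nil mul1g | right].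
rewrite /run iterS -/(run G H w n).
case: (run G H w n) => u v [/= nv nu nl pE sz].
rewrite /step; case: ifPn => [hlt|/[dup] nhlt]; first by split=> //; left.
rewrite /halted /= => /eqP g1.
have Dg : Div G dG (first_Gpart G H v).
  rewrite first_Gpart_nth.
  by have [] := Div_GHpart (normal_word_simple 0 nv).
split=> /=.
- exact: normal_word_shift.
- exact: normal_word_rcons.
- move=> _; rewrite last_rcons !first_Gpart_nth nth_shift_word.
  apply: normal_pair_G_shift; try exact: normal_word_simple.
  exact: normal_word_pair.
- by rewrite -cats1 big_cat /= big_seq1 -mulgA prod_shift_word.
- by right; rewrite size_rcons; case: sz nhlt => [->|->].
Qed.

Lemma run_halts k w : normal_form [set: K] dK k w ->
  exists n, halted G H (run G H w n).
Proof.
move=> nw; have [_ aK _ _ _] := gK.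
have [N HN] := atomic_size_bounded k aK; exists N.+1.
have [_ [ou _] _ pE [//|sz]] := run_invariant N.+1 nw.
suff /HN/(_ pE) : word_over (~` [set 1]) (run G H w N.+1).1 by rewrite sz ltnn.
by move=> x /ou[].
Qed.

End ZappaSzepGarside.

Theorem proposition49 (K : monoidType) (G H : set K) (dK dG dH : K)
    (hG : submonoid G) (hH : submonoid H)
    (hZS : zappa_szep G H)
    (hD : zs_garside_structure G H dK dG dH)
    (k g h : K) (w : seq K)
    (hw : normal_form [set: K] dK k w)
    (hk : decomposition G H k (g, h)) :
  (forall n, normal_word [set: K] dK (run G H w n).2) /\
  exists n, [/\ halted G H (run G H w n),
                normal_form G dG g (run G H w n).1 &
                normal_form H dH h (run G H w n).2].
Proof.
have [_ [gK gG gH dKE]] := hD.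
have inv n := run_invariant hG hH hZS gK gG gH dKE n hw.
split=> [n|]; first by have [] := inv n.
have [n hlt] := run_halts hG hH hZS gK gG gH dKE hw.
exists n; have [nv nu _ pE _] := inv n.
have nH := halted_normal_word hG hH hZS gK gG gH dKE nv (eqP hlt).
have [Gg Hh kE] := hk.
(* The two output products lie in [G] and [H] and multiply to [k], so uniqueness of the
   GH-decomposition applies. *)
have [-> ->] : g = \prod_(x <- (run G H w n).1) x /\
               h = \prod_(x <- (run G H w n).2) x.
  apply: (zappa_szep_inj hZS) => //; last by rewrite pE kE.
    by apply: prod_closed => // x /(proj1 nu)[[]].
  by apply: prod_closed => // x /(proj1 nH)[[]].
by [].
Qed.
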